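(* Let $(G,B,N,S)$ be a Tits system of rank $\ell+1$ with $G$ a finite group, and let $\mathfrak{B}$ be its building, a finite simplicial complex of dimension $\ell$. For every integer $i$ with $0\leq i\leq \ell-1$, the maximal eigenvalue $M^i(\mathfrak{B})$ of the Laplace operator $\Delta=\delta d$ acting on $C^i(\mathfrak{B})$ is $$M^i(\mathfrak{B})=\ell+1.$$
   Context: Tits system (BN-pair) has its usual meaning; its rank is $|S|$. The building $\mathfrak{B}$ of $(G,B,N,S)$ is the simplicial complex whose simplices correspond to the proper parabolic subgroups of $G$ (proper subgroups containing a conjugate of $B$), with the face relation being reverse inclusion; thus vertices correspond to maximal proper parabolic subgroups, and $\ell$-simplices to conjugates of $B$. Every simplex of $\mathfrak{B}$ is a face of an $\ell$-simplex. Let $X$ be a finite simplicial complex of dimension $n$ in which every simplex is a face of some $n$-simplex (for $X=\mathfrak{B}$, $n=\ell$). $\mathrm{Ver}(X)$ is the set of vertices and $S_i(X)$ is the set of oriented $i$-simplices ($i$-simplices with an ordering of the vertices up to even permutation); $\bar s$ is $s$ with the opposite orientation. $C^i(X)$ is the real vector space of functions $f:S_i(X)\to\mathbb{R}$ with $f(\bar s)=-f(s)$ (no condition if $i=0$), and $C^i(X)=0$ for $i<0$ or $i>n$. For a simplex $s$, $w(s)$ is the number of (non-oriented) $n$-simplices of $X$ containing $s$. The coboundary $d:C^i(X)\to C^{i+1}(X)$ is $(df)([v_0,\dots,v_{i+1}])=\sum_{j=0}^{i+1}(-1)^jf([v_0,\dots,\hat v_j,\dots,v_{i+1}])$. The map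 $\delta:C^{i+1}(X)\to C^{i}(X)$ is $(\delta f)(s)=\sum_{v}\frac{w([v,s])}{w(s)}f([v,s])$, the sum being over $v\in\mathrm{Ver}(X)$ such that $\{v\}\cup s$ is an $(i+1)$-simplex, where for $s=[v_0,\dots,v_i]$ one puts $[v,s]=[v,v_0,\dots,v_i]$. The Laplace operator on $C^i(X)$ is $\Delta=\delta d$. It is self-adjoint and positive semi-definite for the inner product $(f,g)=\sum_{s}w(s)f(s)g(s)$ (sum over non-oriented $i$-simplices, each with an arbitrary orientation), so it is diagonalizable with non-negative real eigenvalues. *)

(* Defs.v *)
From HB Require Import structures.
From mathcomp Require Import all_boot all_order all_fingroup all_algebra.
From mathcomp Require Import reals.

Set Implicit Arguments.
Unset Strict Implicit.
Unset Printing Implicit Defensive.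

Import GroupScope.
Import GRing.Theory.

(* The Weyl group is W = N / (B :&: N); a coset s : coset_of (B :&: N) is also
   the subset n (B :&: N) of the ambient group, so that s * B, B * w, ... are
   the usual products "sB", "Bw", ... of subsets. *)
Record tits_system (gT : finGroupType) (G B N : {group gT})
    (S : {set coset_of (B :&: N)}) : Prop := TitsSystem {
  tits_gen : B <*> N = G;
  tits_normal : B :&: N <| N;
  tits_Weyl_gen : <<S>> = N / (B :&: N);
  tits_involution : forall s, s \in S -> #[s] = 2;
  tits_mul : forall s w, s \in S -> w \in N / (B :&: N) ->
    (set_of_coset s * B * set_of_coset w)
      \subset (B * set_of_coset w * B) :|: (B * set_of_coset (s * w) * B);
  tits_conj : forall s, s \in S ->
    ~~ (set_of_coset s * B * set_of_coset s \subset B)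
}.

Arguments tits_system {gT} G B N S.

Section Building.

Variables (gT : finGroupType) (G B : {group gT}).

Definition proper_parabolic (P : {group gT}) : bool :=
  (P \proper G) && [exists g in G, B :^ g \subset P].

Definition maximal_parabolic (M : {group gT}) : bool :=
  [max M | proper_parabolic M].

(* The simplex of P: by reverse inclusion, its vertices are the maximal
   proper parabolics containing P. *)
Definition parabolic_simplex (P : {group gT}) : {set {group gT}} :=
  [set M : {group gT} | maximal_parabolic M & P \subset M].

Definition building : {set {set {group gT}}} :=
  [set parabolic_simplex P | P : {group gT} & proper_parabolic P].

End Building.

Local Open Scope ring_scope.

(* A complex is given by the set X of its (nonempty) simplices, a simplex
   being identified with its set of vertices. *)
Section Cochains.

Variables (R : realType) (V : finType) (X : {set {set V}}).

Definition dimension : nat := (\max_(s in X) #|s|).-1.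

Definition weight (s : {set V}) : nat :=
  #|[set c in X | (#|c| == dimension.+1) && (s \subset c)]|.

(* t = (v_0, ..., v_i), with the v_k distinct *)
Definition vertex_set i (t : {ffun 'I_i.+1 -> V}) : {set V} :=
  [set t k | k : 'I_i.+1].

Definition ordered_simplex i (t : {ffun 'I_i.+1 -> V}) : bool :=
  injectiveb t && (vertex_set t \in X).

Definition reorder i (t : {ffun 'I_i.+1 -> V}) (s : 'S_i.+1) :
  {ffun 'I_i.+1 -> V} := [ffun k => t (s k)].

Definition face i (t : {ffun 'I_i.+2 -> V}) (j : 'I_i.+2) :
  {ffun 'I_i.+1 -> V} := [ffun k => t (lift j k)].

(* [v, v_0, ..., v_i] *)
Definition cons_vertex i (v : V) (t : {ffun 'I_i.+1 -> V}) :
  {ffun 'I_i.+2 -> V} := [ffun k => oapp t v (unlift ord0 k)].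

(* A function f on oriented i-simplices with f (opposite s) = - f s is encoded
   as a function on orderings, invariant under even permutations and negated
   by odd ones; it is extended by 0 to the tuples that do not order an
   i-simplex. *)
Definition is_cochain i : {pred {ffun {ffun 'I_i.+1 -> V} -> R^o}} :=
  fun f =>
  [forall t, ~~ ordered_simplex t ==> (f t == 0)] &&
  [forall t, forall s : 'S_i.+1, f (reorder t s) == (-1) ^+ s * f t].

Arguments is_cochain : clear implicits.

Lemma is_cochainP i (f : {ffun {ffun 'I_i.+1 -> V} -> R^o}) :
  reflect ((forall t, ~~ ordered_simplex t -> f t = 0) /\
           (forall t (s : 'S_i.+1), f (reorder t s) = (-1) ^+ s * f t))
          (f \in is_cochain i).
Proof.
apply: (iffP andP) => -[f0 fN]; split.
- by move=> t /(implyP (forallP f0 t))/eqP.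
- by move=> t s; apply/eqP; move/forallP: fN => /(_ t)/forallP.
- by apply/forallP=> t; apply/implyP=> /f0 ->.
- by apply/forallP=> t; apply/forallP=> s; rewrite fN.
Qed.

Lemma is_cochain_submod i : submod_closed (is_cochain i).
Proof.
split=> [|a f g /is_cochainP[f0 fN] /is_cochainP[g0 gN]]; apply/is_cochainP.
  by split=> *; rewrite !ffunE ?mulr0.
split=> [t Xt|t s]; rewrite !ffunE; first by rewrite f0 // g0 // scaler0 addr0.
by rewrite fN gN mulrDr -!scalerAr.
Qed.

HB.instance Definition _ i :=
  GRing.isSubmodClosed.Build R _ (is_cochain i) (is_cochain_submod i).

Record cochain (i : nat) := Cochain {
  cochain_val :> {ffun {ffun 'I_i.+1 -> V} -> R^o};
  cochain_valP : cochain_val \in is_cochain i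
}.

HB.instance Definition _ i := [isSub for @cochain_val i].
HB.instance Definition _ i := [Choice of cochain i by <:].
HB.instance Definition _ i := [SubChoice_isSubLmodule of cochain i by <:].

Lemma ordered_simplex_reorder i (t : {ffun 'I_i.+1 -> V}) (s : 'S_i.+1) :
  ordered_simplex (reorder t s) = ordered_simplex t.
Proof.
congr (_ && (_ \in X)).
  apply/injectiveP/injectiveP => tI k l; last first.
    by rewrite !ffunE => /tI/perm_inj.
  rewrite -[k](permKV s) -[l](permKV s) => tE.
  by congr (s _); apply: tI; rewrite !ffunE.
apply/setP=> v; apply/imsetP/imsetP => -[k _ ->].
  by exists (s k); rewrite ?ffunE.
by exists (s^-1%g k); rewrite ?ffunE ?permKV.
Qed.

Lemma weight_reorder i (t : {ffun 'I_i.+1 -> V}) (s : 'S_i.+1) :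
  weight (vertex_set (reorder t s)) = weight (vertex_set t).
Proof.
congr weight; apply/setP=> v; apply/imsetP/imsetP => -[k _ ->].
  by exists (s k); rewrite ?ffunE.
by exists (s^-1%g k); rewrite ?ffunE ?permKV.
Qed.

Lemma face_reorder i (t : {ffun 'I_i.+2 -> V}) (s : 'S_i.+2) j :
  exists2 r : 'S_i.+1, face (reorder t s) j = reorder (face t (s j)) r
                     & s = (odd j (+) odd (s j) (+) r) :> bool.
Proof.
pose r0 := (lift_perm (s j) j 1 * s)%g.
have r0j : r0 (s j) = s j by rewrite permM lift_perm_id.
have rK k : exists l, lift (s j) l = r0 (lift (s j) k).
  case: (unliftP (s j) (r0 (lift (s j) k))) => [l ->|]; first by exists l.
  by rewrite -{2}r0j => /perm_inj /eqP; rewrite eq_sym (negPf (neq_lift _ _)).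
pose rf k := sval (sigW (P := fun l => lift (s j) l == r0 (lift (s j) k))
  (let: ex_intro l e := rK k in ex_intro _ l (introT eqP e))).
have rfE k : lift (s j) (rf k) = r0 (lift (s j) k).
  by rewrite /rf; case: sigW => l /= /eqP.
have rI : injective rf.
  by move=> k l /(congr1 (lift (s j))); rewrite !rfE => /perm_inj/lift_inj.
pose r := perm rI.
have sE : s = lift_perm j (s j) r.
  apply/permP=> k; case: (unliftP j k) => [l ->|->]; last by rewrite lift_perm_id.
  by rewrite lift_perm_lift permE rfE permM lift_perm_lift perm1.
exists r; last by rewrite {1}sE odd_lift_perm.
by apply/ffunP=> k; rewrite !ffunE; congr (t _); rewrite {1}sE lift_perm_lift.
Qed.

Lemma cons_vertex_reorder i v (t : {ffun 'I_i.+1 -> V}) (s : 'S_i.+1) :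
  cons_vertex v (reorder t s) = reorder (cons_vertex v t) (lift_perm ord0 ord0 s).
Proof.
apply/ffunP=> k; rewrite !ffunE; case: (unliftP ord0 k) => [l ->|->].
  by rewrite lift_perm_lift !liftK /= ffunE.
by rewrite lift_perm_id !unlift_none.
Qed.

Definition coboundary_fun i (f : {ffun {ffun 'I_i.+1 -> V} -> R^o}) :
  {ffun {ffun 'I_i.+2 -> V} -> R^o} :=
  [ffun t => if ordered_simplex t
             then \sum_(j < i.+2) (-1) ^+ j * f (face t j) else 0].

Definition codifferential_fun i (f : {ffun {ffun 'I_i.+2 -> V} -> R^o}) :
  {ffun {ffun 'I_i.+1 -> V} -> R^o} :=
  [ffun t => if ordered_simplex t
             then \sum_(v | ordered_simplex (cons_vertex v t))
                    (weight (vertex_set (cons_vertex v t)))%:R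
                    / (weight (vertex_set t))%:R * f (cons_vertex v t)
             else 0].

Lemma coboundary_subproof i (f : cochain i) :
  coboundary_fun f \in is_cochain i.+1.
Proof.
case: f => f /= /is_cochainP[f0 fN]; apply/is_cochainP.
split=> [t /negPf Xt|t s]; first by rewrite ffunE Xt.
rewrite !ffunE ordered_simplex_reorder; case: ifP => _; last by rewrite mulr0.
rewrite mulr_sumr [RHS](reindex_inj (@perm_inj _ s)) /=; apply: eq_bigr => j _.
have [r -> ->] := face_reorder t s j.
rewrite fN !mulrA -2!(signr_odd _ (nat_of_ord _)) -!signr_addb.
by congr (_ ^+ _ * _); case: (odd j); case: (odd (s j)); case: (odd_perm r).
Qed.

Lemma codifferential_subproof i (f : cochain i.+1) :
  codifferential_fun f \in is_cochain i.
Proof.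
case: f => f /= /is_cochainP[f0 fN]; apply/is_cochainP.
split=> [t /negPf Xt|t s]; first by rewrite ffunE Xt.
rewrite !ffunE ordered_simplex_reorder; case: ifP => _; last by rewrite mulr0.
rewrite mulr_sumr; apply: eq_big => [v|v _].
  by rewrite cons_vertex_reorder ordered_simplex_reorder.
rewrite cons_vertex_reorder !weight_reorder fN odd_lift_perm.
by rewrite addbb addFb mulrCA.
Qed.

Definition coboundary i (f : cochain i) : cochain i.+1 :=
  Cochain (coboundary_subproof f).

Definition codifferential i (f : cochain i.+1) : cochain i :=
  Cochain (codifferential_subproof f).

Lemma coboundary_linear i : linear (@coboundary i).
Proof.
move=> a f g; apply/val_inj/ffunP=> t; rewrite /= !ffunE.
case: ifP => _; last by rewrite scaler0 addr0.
rewrite scaler_sumr -big_split; apply: eq_bigr => j _ /=.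
by rewrite !ffunE mulrDr scalerAr.
Qed.

HB.instance Definition _ i :=
  GRing.isLinear.Build R (cochain i) (cochain i.+1) _ (@coboundary i)
    (@coboundary_linear i).

Lemma codifferential_linear i : linear (@codifferential i).
Proof.
move=> a f g; apply/val_inj/ffunP=> t; rewrite /= !ffunE.
case: ifP => _; last by rewrite scaler0 addr0.
rewrite scaler_sumr -big_split; apply: eq_bigr => j _ /=.
by rewrite !ffunE mulrDr scalerAr.
Qed.

HB.instance Definition _ i :=
  GRing.isLinear.Build R (cochain i.+1) (cochain i) _ (@codifferential i)
    (@codifferential_linear i).

Definition laplacian i : {linear cochain i -> cochain i} :=
  @codifferential i \o @coboundary i.

End Cochains.

Definition is_eigenvalue (R : realType) (U : lmodType R)
    (T : {linear U -> U}) (a : R) : Prop :=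
  exists2 u : U, u != 0 & T u = a *: u.

Definition is_max_eigenvalue (R : realType) (U : lmodType R)
    (T : {linear U -> U}) (a : R) : Prop :=
  is_eigenvalue T a /\ (forall b, is_eigenvalue T b -> b <= a).

(* Main.v *)
(* For an ordered simplex t, a cochain u and dimension n, summing over chambers gives
     w(t) (Delta u)(t) = (n+1) w(t) u(t)
                         - \sum_(c chamber, t in c) \sum_j \sum_(v in c) u(t[j := v]).
   Pairing the last sum with u yields a sum of squares, so every eigenvalue is at
   most n+1 in any pure complex.  If the vertices carry n+1 types that are
   distinct on each chamber, pulling back a nonzero coclosed cochain of the n-simplex
   along the type map kills the last sum, so n+1 is attained as soon as i < n.

   In the building, maximal proper parabolics containing B are the groups
   generated by B and S minus s, and s is the type.  This rests on: a subgroup X that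
   contains B and wBw^-1 contains every letter of a reduced word of w. Hence the
   overgroups of B are generated by B and subsets of S, and two of them
   are conjugate only if they are equal. *)
Require Import Defs.
From mathcomp Require Import all_boot all_order all_fingroup all_algebra.
From mathcomp Require Import reals ring.

Set Implicit Arguments.
Unset Strict Implicit.
Unset Printing Implicit Defensive.

(** * Word length with respect to a generating set of a finite group *)

Section WordLength.

Import GroupScope.

Variables (gT : finGroupType) (I : {set gT}).

Lemma wlen_subproof w : exists n, (w \notin <<I>>) || (w \in (1 |: I) ^+ n).
Proof. by have [n defI] := gen_expgs I; exists n; rewrite defI orNb. Qed.

(** Powers of [1 |: I] collect the words of at most [n] letters. Elements outside [<<I>>] get length
    0. *)
Definition wlen w := ex_minn (wlen_subproof w).

Lemma wlen_mem w : w \in <<I>> -> w \in (1 |: I) ^+ wlen w.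
Proof. by rewrite /wlen; case: ex_minnP => n + _ Iw; rewrite Iw. Qed.

Lemma wlen_le n w : w \in (1 |: I) ^+ n -> wlen w <= n.
Proof. by rewrite /wlen; case: ex_minnP => m _ min_m Iw; rewrite min_m ?Iw ?orbT. Qed.

Lemma wlenMl s w : s \in I -> w \in <<I>> -> wlen (s * w) <= (wlen w).+1.
Proof.
move=> Is Iw; apply: wlen_le; rewrite expgS mem_mulg ?wlen_mem //.
by rewrite !inE Is orbT.
Qed.

Lemma wlenMr s w : s \in I -> w \in <<I>> -> wlen (w * s) <= (wlen w).+1.
Proof.
move=> Is Iw; apply: wlen_le; rewrite expgSr mem_mulg ?wlen_mem //.
by rewrite !inE Is orbT.
Qed.

Lemma wlen_descentl w :
  w \in <<I>> -> w != 1 -> exists2 s, s \in I & wlen (s^-1 * w) < wlen w.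
Proof.
move=> /wlen_mem; case def_n: (wlen w) => [|n]; first by rewrite inE => ->.
rewrite expgS => /mulsgP[s v]; rewrite !inE => Is Iv def_w nt_w.
have lt_n: n < wlen w by rewrite def_n.
case/predU1P: Is => [s1|Is].
  by move: (wlen_le Iv); rewrite leqNgt -[v]mul1g -s1 -def_w lt_n.
by exists s; rewrite // def_w mulKg ltnS wlen_le.
Qed.

Lemma wlen_descentr w :
  w \in <<I>> -> w != 1 -> exists2 s, s \in I & wlen (w * s^-1) < wlen w.
Proof.
move=> /wlen_mem; case def_n: (wlen w) => [|n]; first by rewrite inE => ->.
rewrite expgSr => /mulsgP[v s Iv]; rewrite !inE => Is def_w nt_w.
have lt_n: n < wlen w by rewrite def_n.
case/predU1P: Is => [s1|Is].
  by move: (wlen_le Iv); rewrite leqNgt -[v]mulg1 -s1 -def_w lt_n.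
by exists s; rewrite // def_w mulgK ltnS wlen_le.
Qed.

End WordLength.

(** * Bruhat cells of a Tits system and the subgroups containing [B] *)

Section BruhatCells.

Import GroupScope.

Variables (gT : finGroupType) (G B N : {group gT}).
Variable S : {set coset_of (B :&: N)}.
Hypothesis hTits : tits_system G B N S.

Let T := B :&: N.
Implicit Types (w v s : coset_of T) (I J : {set coset_of T}) (X : {group gT}).

Definition cell w : {set gT} := B * set_of_coset w * B.

Lemma tits_subW : S \subset N / T.
Proof. by rewrite -(tits_Weyl_gen hTits) subset_gen. Qed.

Lemma tits_invV s : s \in S -> s^-1 = s.
Proof.
move=> Ss; apply/eqP; rewrite eq_invg_mul -expg2.
by rewrite -(tits_involution hTits Ss) expg_order.
Qed.

Lemma gen_subW I w : I \subset S -> w \in <<I>> -> w \in N / T.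
Proof.
by move=> sIS; rewrite -(tits_Weyl_gen hTits); apply/subsetP; rewrite genS.
Qed.

Lemma coset_subN w : w \in N / T -> set_of_coset w \subset N.
Proof.
case/morphimP=> n nTn Nn ->; rewrite val_coset //.
by rewrite mul_subG ?subsetIr ?sub1set.
Qed.

Lemma coset_rep w : exists2 n, n \in 'N(T) & w = coset T n.
Proof. by have [n] := cosetP w; exists n. Qed.

(** [T] is absorbed by [B], so a cell is a single double coset of [B]; two cells that meet are
    therefore equal. *)
Lemma cellE w x : x \in cell w -> cell w = B :* x * B.
Proof.
have [n nTn ->] := coset_rep w; rewrite /cell val_coset //.
rewrite mulgA (mulGSid (subsetIl _ _)).
case/mulsgP=> y b /rcosetP[b1 Bb1 ->] Bb ->.
by rewrite !rcosetM (rcoset_id Bb1) -[RHS]mulgA lcoset_id.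
Qed.

Lemma cell_id w n : n \in set_of_coset w -> n \in cell w.
Proof. by move=> wn; rewrite -[n]mul1g -[_ * n]mulg1 !mem_mulg. Qed.

Lemma cell_eq x w v : x \in cell w -> x \in cell v -> cell w = cell v.
Proof. by move=> /cellE-> /cellE->. Qed.

Lemma cell_nonempty w : exists x, x \in cell w.
Proof.
have [n nTn ->] := coset_rep w; exists n; apply: cell_id.
by rewrite val_coset ?rcoset_refl.
Qed.

Lemma cell_sub_eq w v : cell w \subset cell v -> cell w = cell v.
Proof.
by have [x wx] := cell_nonempty w => /subsetP/(_ x wx); apply: cell_eq.
Qed.

Lemma set_of_coset1 : set_of_coset (1 : coset_of T) = T.
Proof. exact: genGid. Qed.

Lemma cell1 : cell 1 = B.
Proof.
by rewrite /cell set_of_coset1 (mulGSid (subsetIl _ _)) mulGid.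
Qed.

Lemma cellV w : (cell w)^-1 = cell w^-1.
Proof. by rewrite /cell !invMg !invGid mulgA. Qed.

Lemma cell_mulB w : cell w * B = cell w.
Proof. by rewrite /cell -mulgA mulGid. Qed.

Lemma cell_Bmul w : B * cell w = cell w.
Proof. by rewrite /cell !mulgA mulGid. Qed.

Lemma cellM_sub w v : cell (w * v) \subset cell w * cell v.
Proof.
have -> : cell (w * v) = B * (set_of_coset w * 1 * set_of_coset v) * B.
  by rewrite /cell mulg1.
have -> : cell w * cell v = B * (set_of_coset w * B * set_of_coset v) * B.
  by rewrite /cell !mulgA -(mulgA _ B B) mulGid.
by rewrite mulSg // mulgS // mulSg // mulgS // sub1G.
Qed.

Lemma cell_mull s w : s \in S -> w \in N / T ->
  cell s * cell w \subset cell w :|: cell (s * w).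
Proof.
move=> Ss Ww.
have -> : cell s * cell w = B * (set_of_coset s * B * set_of_coset w) * B.
  by rewrite /cell !mulgA -(mulgA _ B B) mulGid.
apply: subset_trans (mulSg _ (mulgS _ (tits_mul hTits Ss Ww))) _.
by rewrite mulgU mulUg -/(cell _) -/(cell _) !cell_Bmul !cell_mulB.
Qed.

Lemma cell_mulr s w : s \in S -> w \in N / T ->
  cell w * cell s \subset cell w :|: cell (w * s).
Proof.
move=> Ss Ww; rewrite -invSg invMg invUg !cellV invMg (tits_invV Ss).
by rewrite cell_mull ?groupV.
Qed.

(** Some [x] in [sBs] lies outside [B]. As [s * s = 1], the product axiom then puts [x] in [BsB], so
    [BsB = BxB] is contained in [BsBsB]. *)
Lemma cell_sq s : s \in S -> cell s \subset cell s * cell s.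
Proof.
move=> Ss; have /subsetPn[x sx nBx] := tits_conj hTits Ss.
have Ws := subsetP tits_subW _ Ss.
have := subsetP (tits_mul hTits Ss Ws) x sx.
have -> : s * s = 1 by rewrite -{1}(tits_invV Ss) mulVg.
rewrite -/(cell s) -/(cell 1) cell1 inE (negPf nBx) orbF => /cellE def_s.
rewrite {1}def_s.
have -> : cell s * cell s = B * (set_of_coset s * B * set_of_coset s) * B.
  by rewrite /cell !mulgA -(mulgA _ B B) mulGid.
by apply: mulSg; apply: mulgS; rewrite sub1set.
Qed.

(** Uniqueness in the Bruhat decomposition, by induction on the smaller length. For a left descent
    [s] of the shorter element [w], [cell (s * w)] lies in [cell s * cell v], so it is [cell v] or
    [cell (s * v)]. By induction [s * w] is [v], which the lengths exclude, or [s * v]. *)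
Lemma cell_inj w v : w \in N / T -> v \in N / T -> cell w = cell v -> w = v.
Proof.
have cell1_inj u : u \in N / T -> cell u = B -> u = 1.
  case/morphimP=> n nTn Nn -> cellB; apply: coset_id; rewrite inE Nn andbT.
  by rewrite -cellB cell_id // val_coset // rcoset_refl.
rewrite -(tits_Weyl_gen hTits) => Ww Wv.
wlog: w v Ww Wv / wlen S w <= wlen S v => [IH|].
  by case/orP: (leq_total (wlen S w) (wlen S v)) => le_wv; [|move/esym]; move/IH => ->.
have [n] := ubnP (wlen S w); elim: n w v Ww Wv => // n IHn w v Ww Wv.
rewrite ltnS => le_wn le_wv eq_wv.
have [w1|nt_w] := eqVneq w 1.
  rewrite w1; apply/esym/cell1_inj; first by rewrite -(tits_Weyl_gen hTits).
  by rewrite -eq_wv w1 cell1.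
have [s Ss] := wlen_descentl Ww nt_w; rewrite tits_invV // => lt_sw.
have ssK u : s * (s * u) = u by rewrite -{1}(tits_invV Ss) mulKg.
have Wsw u : u \in <<S>> -> s * u \in <<S>>.
  by move=> Wu; apply: groupM => //; apply: mem_gen.
have [x swx] := cell_nonempty (s * w).
have := subsetP (cellM_sub _ _) _ swx.
rewrite eq_wv => /(subsetP (cell_mull Ss (gen_subW (subxx S) Wv))).
have lt_swn := leq_trans lt_sw le_wn.
case/setUP=> [/(cell_eq swx)|/(cell_eq swx)] /(IHn _ _ (Wsw _ Ww)) eq_sw.
  have def_v := eq_sw Wv lt_swn (leq_trans (ltnW lt_sw) le_wv).
  by rewrite def_v ltnNge le_wv in lt_sw.
apply: (mulgI s); apply: eq_sw; rewrite ?Wsw // -ltnS.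
apply: leq_trans lt_sw _; apply: leq_trans le_wv _.
by rewrite -{1}[v]ssK wlenMl // Wsw.
Qed.

Lemma tits_neq1 s : s \in S -> s != 1.
Proof. by move=> Ss; rewrite -order_gt1 (tits_involution hTits Ss). Qed.

(** Write [v = u * t] with [t] a right descent. If [cell s * cell v] met [cell v], some [y * z1]
    with [y] in [cell s] and [z1] in [cell u] would lie in [cell v] or [cell u], and by induction in
    [cell (s * u)]. Then [s * u = v] contradicts the lengths, and [s * u = u] contradicts [s != 1].
    Lengths are taken in [I], so that this applies to words in a subset of [S]. *)
Lemma cell_ascent I s v : I \subset S -> s \in I -> v \in <<I>> ->
  wlen I v <= wlen I (s * v) -> cell s * cell v = cell (s * v).
Proof.
move=> sIS Is; have Ss := subsetP sIS s Is; have IW := gen_subW sIS.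
have Ws : s \in N / T by rewrite IW ?mem_gen.
have [n] := ubnP (wlen I v); elim: n v => // n IHn v le_vn Iv le_sv.
have Wv := IW v Iv.
have [->|nt_v] := eqVneq v 1; first by rewrite mulg1 cell1 cell_mulB.
apply/eqP; rewrite eqEsubset cellM_sub andbT; apply/subsetP=> x sv_x.
have /setUP[vx|//] := subsetP (cell_mull Ss Wv) x sv_x; exfalso.
have [t It] := wlen_descentr Iv nt_v; have St := subsetP sIS t It.
rewrite tits_invV //; set u := v * t => lt_uv.
have Iu : u \in <<I>> := groupM Iv (mem_gen It).
have utK : u * t = v by rewrite /u -{2}(tits_invV St) mulgK.
case/mulsgP: sv_x => y z sy; rewrite -utK => /(subsetP (cellM_sub _ _)).
case/mulsgP=> z1 z2 uz1 tz2 -> def_x.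
have /setUP v_yz1 : y * z1 \in cell v :|: cell u.
  have -> : y * z1 = x * z2^-1 by rewrite def_x mulgA mulgK.
  apply: (subsetP (cell_mulr St Wv)); rewrite mem_mulg //.
  by rewrite -(tits_invV St) -cellV mem_invg invgK.
have su_yz1 : y * z1 \in cell (s * u).
  rewrite -IHn ?mem_mulg //; first exact: leq_trans lt_uv le_vn.
  rewrite -ltnS; apply: leq_trans lt_uv _; apply: leq_trans le_sv _.
  by rewrite -utK mulgA wlenMr // (groupM (mem_gen Is) Iu).
have Wsu : s * u \in N / T := groupM Ws (IW u Iu).
case: v_yz1 => /(cell_eq su_yz1)/(cell_inj Wsu) eq_su.
  have eq_sv : s * v = u by rewrite -eq_su // -{1}(tits_invV Ss) mulKg.
  by rewrite eq_sv leqNgt lt_uv in le_sv.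
case/eqP: (tits_neq1 Ss); apply: (mulIg u); rewrite mul1g.
exact: eq_su (IW u Iu).
Qed.

(** [s] is an ascent of [s * w], so [cell w = cell s * cell (s * w)]; now replace [cell s] by the
    larger [cell s * cell s]. *)
Lemma cell_descent I s w : I \subset S -> s \in I -> w \in <<I>> ->
  wlen I (s^-1 * w) < wlen I w -> cell w \subset cell s * cell w.
Proof.
move=> sIS Is Iw; have Ss := subsetP sIS s Is; rewrite tits_invV // => lt_sw.
have ssK : s * (s * w) = w by rewrite -{1}(tits_invV Ss) mulKg.
have := cell_ascent sIS Is (groupM (mem_gen Is) Iw).
rewrite ssK => /(_ (ltnW lt_sw)) <-.
by apply: subset_trans (mulSg _ (cell_sq Ss)) _; rewrite -mulgA.
Qed.

Definition std_parabolic I : {group gT} :=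
  (B <*> \bigcup_(s in I) set_of_coset s)%G.

Lemma sub_std_parabolic I : B \subset std_parabolic I.
Proof. exact: joing_subl. Qed.

Lemma coset_sub_std_parabolic I s :
  s \in I -> set_of_coset s \subset std_parabolic I.
Proof.
by move=> Is; rewrite (subset_trans _ (joing_subr _ _)) // (bigcup_sup s).
Qed.

Lemma std_parabolic_sub I X : B \subset X ->
  (forall s, s \in I -> set_of_coset s \subset X) -> std_parabolic I \subset X.
Proof. by move=> sBX sIX; rewrite join_subG sBX; apply/bigcupsP. Qed.

Lemma std_parabolicS I J :
  I \subset J -> std_parabolic I \subset std_parabolic J.
Proof.
move=> /subsetP sIJ; apply: std_parabolic_sub; rewrite ?sub_std_parabolic //.
by move=> s /sIJ; apply: coset_sub_std_parabolic.
Qed.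

(** The union of the cells of [<<I>>] is stable under left multiplication by the generators, those
    in [B] and those in a coset [s] of [I]. *)
Lemma mem_std_parabolic I x : I \subset S -> x \in std_parabolic I ->
  exists2 w, w \in <<I>> & x \in cell w.
Proof.
move=> sIS; rewrite /= /joing; set A := _ :|: _.
have [n ->] := gen_expgs A; elim: n x => [|n IHn] x.
  by move/set1P->; exists 1; rewrite ?group1 // cell1 group1.
rewrite expgS => /mulsgP[y z Ay /IHn[w Iw wz] ->].
case/setU1P: Ay => [->|]; first by exists w; rewrite ?mul1g.
case/setUP=> [By | /bigcupP[s Is sy]].
  by exists w; rewrite // -cell_Bmul mem_mulg.
have := subsetP (cell_mull (subsetP sIS s Is) (gen_subW sIS Iw)) (y * z).
move/(_ (mem_mulg (cell_id sy) wz))/setUP => -[] yz; first by exists w.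
by exists (s * w); first exact: groupM (mem_gen Is) Iw.
Qed.

Lemma tits_subG : B \subset G /\ N \subset G.
Proof. by rewrite -(tits_gen hTits) joing_subl joing_subr. Qed.

Lemma std_parabolic_subG I : I \subset S -> std_parabolic I \subset G.
Proof.
have [sBG sNG] := tits_subG => /subsetP sIS; apply: std_parabolic_sub => // s Is.
by rewrite (subset_trans _ sNG) // coset_subN // (subsetP tits_subW) ?sIS.
Qed.

(** The intersection with [N] contains [T] and, modulo [T], all of [S]; hence it is [N]. *)
Lemma std_parabolic_full : std_parabolic S = G.
Proof.
apply/eqP; rewrite -val_eqE eqEsubset std_parabolic_subG //=.
rewrite -{1}(tits_gen hTits) join_subG joing_subl.
have /andP[sTN nTN] := tits_normal hTits.
suff: N \subset std_parabolic S :&: N by rewrite subsetI => /andP[].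
rewrite -(quotientSGK nTN); last by rewrite setSI ?sub_std_parabolic.
rewrite -(tits_Weyl_gen hTits) gen_subG; apply/subsetP=> s Ss.
have /morphimP[n nTn Nn def_s] := subsetP tits_subW s Ss.
rewrite def_s mem_quotient // inE Nn andbT.
apply: (subsetP (coset_sub_std_parabolic Ss)).
by rewrite def_s val_coset ?rcoset_refl.
Qed.

(* For a left descent [s] of [w], [BwB] is contained in [BsB * BwB], so [BsB]
   meets [B * wBw^-1 * B]: the first letter of a reduced word of [w] lies in [X]. *)
Lemma coset_sub_conj X w : B \subset X -> w \in N / T ->
    set_of_coset w * B * set_of_coset w^-1 \subset X ->
  set_of_coset w \subset std_parabolic [set s in S | set_of_coset s \subset X].
Proof.
set J := [set s in S | _] => sBX; rewrite -(tits_Weyl_gen hTits).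
have [n] := ubnP (wlen S w); elim: n w => // n IHn w le_wn Ww sX.
have [->|nt_w] := eqVneq w 1.
  by rewrite set_of_coset1 (subset_trans (subsetIl _ _)) ?sub_std_parabolic.
have [s Ss lt_sw] := wlen_descentl Ww nt_w.
have sSX : set_of_coset s \subset X.
  have [m nTm def_w] := coset_rep w.
  have wm : m \in set_of_coset w by rewrite def_w val_coset ?rcoset_refl.
  have /mulsgP[y z sy wz def_m] :=
    subsetP (cell_descent (subxx S) Ss Ww lt_sw) m (cell_id wm).
  (* Here [m = y * z] with [z] in [B m B], which puts [y] in [m B m^-1 B]. *)
  have Xy : y \in X.
    move: wz; rewrite (cellE (cell_id wm)).
    case/mulsgP=> z1 b /rcosetP[b1 Bb1 ->] Bb def_z.
    have -> : y = m * b^-1 * m^-1 * b1^-1.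
      by rewrite -[y](mulgK z) -def_m def_z !invMg !mulgA.
    rewrite groupMr; last by rewrite groupV (subsetP sBX).
    apply: (subsetP sX).
    by rewrite !mem_mulg ?groupV // mem_invg invgK.
  apply/subsetP=> q /cell_id; rewrite (cellE sy).
  case/mulsgP=> z1 b /rcosetP[b1 /(subsetP sBX) Xb1 ->] /(subsetP sBX) Xb ->.
  by rewrite !groupM.
have Js : s \in J by rewrite inE Ss.
have ssK : s * (s^-1 * w) = w by rewrite mulKVg.
rewrite -ssK -[set_of_coset _]/(set_of_coset s * set_of_coset (s^-1 * w)).
apply: mul_subG; first exact: coset_sub_std_parabolic.
apply: IHn (leq_trans lt_sw le_wn) (groupM (groupVr (mem_gen Ss)) Ww) _.
have -> : set_of_coset (s^-1 * w) * B * set_of_coset (s^-1 * w)^-1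
        = set_of_coset s * (set_of_coset w * B * set_of_coset w^-1) * set_of_coset s.
  by rewrite invMg invgK {1}(tits_invV Ss) !mulgA.
by rewrite mul_subG // mul_subG.
Qed.

Lemma cell_cover x : x \in G -> exists2 w, w \in N / T & x \in cell w.
Proof.
rewrite -std_parabolic_full => /(mem_std_parabolic (subxx S))[w Ww wx].
by exists w; rewrite // (gen_subW (subxx S)).
Qed.

(** Write [g^-1 = b * m * b'] with [m] in the coset [w]. Then [wBw^-1] is the conjugate of [B :^ g]
    by [b^-1], so it lies in [X], and [coset_sub_conj] captures [m]. *)
Lemma conj_mem X g : B \subset X -> g \in G -> B :^ g \subset X ->
  g \in std_parabolic [set s in S | set_of_coset s \subset X].
Proof.
move=> sBX Gg sBgX; set P := std_parabolic _.
have sBP : B \subset P := sub_std_parabolic _.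
have [|w Ww] := @cell_cover g^-1; first by rewrite groupV.
case/mulsgP=> z b' /mulsgP[b m Bb wm ->] Bb' def_g.
suff Pm : m \in P by rewrite -groupV def_g !groupM // (subsetP sBP).
apply: (subsetP _ m wm); apply: coset_sub_conj => //.
have [q nTq def_w] := coset_rep w.
have def_wm : set_of_coset w = m *: T.
  move: wm; rewrite def_w val_coset // (norm_rlcoset nTq).
  by move/lcoset_eqP.
apply/subsetP=> _ /mulsgP[_ y' /mulsgP[y b0 wy Bb0 ->] + ->].
rewrite -[set_of_coset w^-1]/((set_of_coset w)^-1) mem_invg.
move: wy; rewrite def_wm => /lcosetP[t /setIP[Bt _] ->] /lcosetP[t' /setIP[Bt' _] def_y'].
have -> : m * t * b0 * y' = b^-1 * (b'^-1 * t * b0 * t'^-1 * b') ^ g * b.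
  have def_m : m = b^-1 * g^-1 * b'^-1 by rewrite def_g -mulgA mulgK mulKg.
  by rewrite -[y']invgK def_y' def_m conjgE !invMg !invgK !mulgA.
have Xg : (b'^-1 * t * b0 * t'^-1 * b') ^ g \in X.
  by rewrite (subsetP sBgX) // memJ_conjg !groupM ?groupV.
have Xb := subsetP sBX b Bb.
exact: groupM (groupM (groupVr Xb) Xg) Xb.
Qed.

(** Overgroups of [B] are self-normalizing, in a strong form: it is enough that [g] carries [B] into
    [X]. *)
Lemma normalizing X g : B \subset X -> X \subset G -> g \in G ->
  B :^ g \subset X -> g \in X.
Proof.
move=> sBX sXG Gg /(conj_mem sBX Gg); apply: subsetP.
by apply: std_parabolic_sub => // s; rewrite inE => /andP[].
Qed.

Lemma overgroup_std X : B \subset X -> X \subset G ->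
  X = std_parabolic [set s in S | set_of_coset s \subset X].
Proof.
move=> sBX sXG; apply/val_inj/eqP; rewrite /= eqEsubset; apply/andP; split.
  apply/subsetP=> x Xx; apply: conj_mem; rewrite ?(subsetP sXG) //.
  by rewrite -(conjGid Xx) conjSg.
by apply: std_parabolic_sub => // s; rewrite inE => /andP[].
Qed.

(** Uniqueness of cells gives [s \in <<I>>]. The first letter [t] of a shortest word of [s] in [I]
    satisfies [cell s \subset cell t * cell s], so [t] cannot be an ascent of [s] for the length in
    [S]. Hence [t * s] has length 0 there, and [s = t] belongs to [I]. *)
Lemma coset_in_std_parabolic I s : I \subset S -> s \in S ->
  (set_of_coset s \subset std_parabolic I) = (s \in I).
Proof.
move=> sIS Ss; apply/idP/idP; last exact: coset_sub_std_parabolic.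
have Ws := subsetP tits_subW s Ss.
have [n nTn def_s] := coset_rep s.
have sn : n \in set_of_coset s by rewrite def_s val_coset ?rcoset_refl.
move/subsetP/(_ n sn)/(mem_std_parabolic sIS)=> [w Iw wn].
have := cell_eq (cell_id sn) wn => /(cell_inj Ws (gen_subW sIS Iw)) eq_sw.
rewrite -eq_sw in Iw.
have [t It lt_ts] := wlen_descentl Iw (tits_neq1 Ss).
have St := subsetP sIS t It.
have Wts : t * s \in N / T := groupM (subsetP tits_subW t St) Ws.
have sub_ts := cell_descent sIS It Iw lt_ts.
have len_s : wlen S s <= 1.
  by apply: wlen_le; rewrite expg1 !inE Ss orbT.
case: (leqP (wlen S s) (wlen S (t * s))) => [|lt_ts1].
  move/(cell_ascent (subxx S) St (mem_gen Ss)) => def_ts.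
  rewrite def_ts in sub_ts.
  have := cell_inj Ws Wts (cell_sub_eq sub_ts).
  rewrite -{1}[s]mul1g => /mulIg t1.
  by case/eqP: (tits_neq1 St).
have : wlen S (t * s) = 0 by apply/eqP; rewrite -leqn0 -ltnS (leq_trans lt_ts1).
have Sts : t * s \in <<S>> := groupM (mem_gen St) (mem_gen Ss).
move=> len0; have := wlen_mem Sts; rewrite len0 inE -eq_invg_mul => /eqP <-.
by rewrite tits_invV.
Qed.

End BruhatCells.

(** * Replacing one vertex of an ordered simplex *)

Section Replace.

Import GRing.Theory Num.Theory.
Local Open Scope ring_scope.

Variable V : finType.

Definition replace i (t : {ffun 'I_i.+1 -> V}) j v : {ffun 'I_i.+1 -> V} :=
  [ffun k => if k == j then v else t k].

Lemma replaceK i (t : {ffun 'I_i.+1 -> V}) j v : replace (replace t j v) j (t j) = t.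
Proof. by apply/ffunP=> k; rewrite !ffunE; case: eqP => // ->. Qed.

Lemma replace_id i (t : {ffun 'I_i.+1 -> V}) j : replace t j (t j) = t.
Proof. by apply/ffunP=> k; rewrite ffunE; case: eqP => // ->. Qed.

Lemma replace_twice i (t : {ffun 'I_i.+1 -> V}) j v v' :
  replace (replace t j v) j v' = replace t j v'.
Proof. by apply/ffunP=> k; rewrite !ffunE; case: eqP. Qed.

Lemma mem_vertex_set i (t : {ffun 'I_i.+1 -> V}) k : t k \in vertex_set t.
Proof. exact: imset_f. Qed.

Lemma vertex_set_subP i (t : {ffun 'I_i.+1 -> V}) (c : {set V}) :
  reflect (forall k, t k \in c) (vertex_set t \subset c).
Proof.
apply: (iffP subsetP) => [sub_tc k|t_c _ /imsetP[k _ ->]] //.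
exact/sub_tc/mem_vertex_set.
Qed.

Lemma vertex_set_neq0 i (t : {ffun 'I_i.+1 -> V}) : vertex_set t != set0.
Proof. by apply/set0Pn; exists (t ord0); apply: mem_vertex_set. Qed.

Lemma vertex_set_replace_sub i (t : {ffun 'I_i.+1 -> V}) j v (c : {set V}) :
  v \in c -> vertex_set t \subset c -> vertex_set (replace t j v) \subset c.
Proof.
by move=> c_v /vertex_set_subP t_c; apply/vertex_set_subP=> k; rewrite ffunE; case: ifP.
Qed.

Lemma replace_noninjective i (t : {ffun 'I_i.+1 -> V}) j k :
  k != j -> ~~ injectiveb (replace t j (t k)).
Proof.
move=> nkj; apply/injectiveP=> /(_ k j); rewrite !ffunE eqxx (negPf nkj).
by move=> /(_ erefl) /eqP; rewrite (negPf nkj).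
Qed.

Lemma vertex_set_cons i v (t : {ffun 'I_i.+1 -> V}) :
  vertex_set (cons_vertex v t) = v |: vertex_set t.
Proof.
apply/setP=> x; rewrite in_setU1; apply/imsetP/predU1P => [[k _ ->]|].
  rewrite ffunE; case: unliftP => [k' _|_]; last by left.
  by right; apply: mem_vertex_set.
case=> [->|/imsetP[k _ ->]]; first by exists ord0; rewrite // ffunE unlift_none.
by exists (lift ord0 k); rewrite // ffunE liftK.
Qed.

Lemma injective_cons i v (t : {ffun 'I_i.+1 -> V}) :
  injectiveb (cons_vertex v t) = (v \notin vertex_set t) && injectiveb t.
Proof.
have consS k : cons_vertex v t (lift ord0 k) = t k by rewrite ffunE liftK.
have cons0 : cons_vertex v t ord0 = v by rewrite ffunE unlift_none.
apply/injectiveP/andP=> [inj_vt | [t'v /injectiveP inj_t] k k'].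
  split; last first.
    by apply/injectiveP=> k k'; rewrite -!consS => /inj_vt /lift_inj.
  by apply/imsetP=> [[k _]]; rewrite -consS -{1}cons0 => /inj_vt.
case: (unliftP ord0 k) => [l ->|->]; case: (unliftP ord0 k') => [l' ->|->] //.
- by rewrite !consS => /inj_t ->.
- by rewrite consS cons0 => def_v; rewrite -def_v mem_vertex_set in t'v.
- by rewrite consS cons0 => def_v; rewrite def_v mem_vertex_set in t'v.
Qed.

Lemma face_cons0 i v (t : {ffun 'I_i.+1 -> V}) : face (cons_vertex v t) ord0 = t.
Proof. by apply/ffunP=> k; rewrite !ffunE liftK. Qed.

(** The permutation is the cycle that brings the leading [v] to place [j]; its sign is
    [(-1) ^+ j]. *)
Lemma face_consS i v (t : {ffun 'I_i.+1 -> V}) j :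
  face (cons_vertex v t) (lift ord0 j) = reorder (replace t j v) (lift_perm ord0 j 1).
Proof.
apply/ffunP=> k; rewrite !ffunE; case: (unliftP ord0 k) => [l ->|->].
  rewrite lift_perm_lift perm1 eq_sym (negPf (neq_lift _ _)).
  suff -> : lift (lift ord0 j) (lift ord0 l) = lift ord0 (lift j l) by rewrite liftK.
  by apply: val_inj; rewrite /= /bump /= !add1n ltnS addnS.
rewrite lift_perm_id eqxx.
suff -> : lift (lift ord0 j) ord0 = ord0 by rewrite unlift_none.
exact: val_inj.
Qed.

(* After multiplication by [#|c|] this is the sum over [t] of the squares of
   [\sum_(v in c) u (replace t j v)]. *)
Lemma sum_replace_ge0 (R : realDomainType) i (u : {ffun 'I_i.+1 -> V} -> R)
    j (c : {set V}) :
  0 <= \sum_(t | vertex_set t \subset c) \sum_(v in c) u t * u (replace t j v).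
Proof.
have [->|[v0 c_v0]] := set_0Vmem c.
  by apply: sumr_ge0 => t _; rewrite big_set0.
have c_gt0 : (0 < #|c|)%N by apply/card_gt0P; exists v0.
pose h t := \sum_(v in c) u (replace t j v).
have hE t v : h (replace t j v) = h t.
  by apply: eq_bigr => v' _; rewrite replace_twice.
rewrite -(pmulrn_lge0 _ c_gt0) -sumrMnl.
have -> : \sum_(t | vertex_set t \subset c)
            (\sum_(v in c) u t * u (replace t j v)) *+ #|c|
        = \sum_(t | vertex_set t \subset c) \sum_(v in c) u t * h t.
  by apply: eq_bigr => t _; rewrite -mulr_sumr sumr_const.
rewrite pair_big_dep /=.
(* Exchanging [t j] with [v] permutes the pairs and turns [u t] into [u (replace t j v)], while
   [h t] is unchanged. Summing over [v] then produces a second factor [h t]. *)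
pose swap (p : {ffun 'I_i.+1 -> V} * V) := (replace p.1 j p.2, p.1 j).
have swapK : involutive swap.
  by case=> t v; rewrite /swap /= replaceK ffunE eqxx.
rewrite (reindex_inj (inv_inj swapK)) /=.
have -> : \sum_(p | (vertex_set (replace p.1 j p.2) \subset c) && (p.1 j \in c))
             u (replace p.1 j p.2) * h (replace p.1 j p.2)
        = \sum_(p | (vertex_set p.1 \subset c) && (p.2 \in c))
             u (replace p.1 j p.2) * h p.1.
  apply: eq_big => [[t v]|[t v] _] /=; last by rewrite hE.
  apply/andP/andP=> -[] /vertex_set_subP t_c c_v; split; rewrite //.
  - apply/vertex_set_subP=> k; have := t_c k; rewrite ffunE.
    by case: eqP => // ->.
  - by have := t_c j; rewrite ffunE eqxx.
  - by apply: vertex_set_replace_sub => //; apply/vertex_set_subP.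
rewrite -(pair_big_dep (fun t => vertex_set t \subset c) (fun _ v => v \in c)
  (fun t v => u (replace t j v) * h t)) /=.
by apply: sumr_ge0 => t _; rewrite -mulr_suml -expr2 sqr_ge0.
Qed.

End Replace.

(** * The Laplacian of a pure complex in which every chamber carries each colour of [A] once *)

Section ColouredComplex.

Import GRing.Theory Num.Theory Order.TTheory.
Local Open Scope ring_scope.

Variables (R : realType) (V K : finType) (X : {set {set V}}).
Variables (tau : V -> K) (A : {set K}) (n : nat).

Hypothesis cardA : #|A| = n.+1.
Hypothesis X_neq0 : X != set0.
Hypothesis X_closed : forall s r : {set V},
  s \in X -> r \subset s -> r != set0 -> r \in X.
Hypothesis X_pure : forall s, s \in X ->
  exists c, [/\ c \in X, s \subset c, {in c &, injective tau} & tau @: c = A].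

Definition chambers := [set c in X | #|c| == n.+1].

Lemma chamberP c : c \in chambers ->
  [/\ c \in X, #|c| = n.+1, {in c &, injective tau} & tau @: c = A].
Proof.
rewrite inE => /andP[Xc /eqP card_c].
have [c' [Xc' s_cc' inj_c' im_c']] := X_pure Xc.
have card_c' : #|c'| = n.+1 by rewrite -cardA -im_c' card_in_imset.
suff -> : c = c' by [].
by apply/eqP; rewrite eqEcard s_cc' card_c card_c' /=.
Qed.

Lemma chamber_exists s : s \in X -> exists2 c, c \in chambers & s \subset c.
Proof.
move/X_pure=> [c [Xc s_sc inj_c im_c]]; exists c => //.
by rewrite inE Xc -cardA -im_c card_in_imset /=.
Qed.

Lemma dimensionE : dimension X = n.
Proof.
rewrite /dimension; suff -> : (\max_(s in X) #|s|)%N = n.+1 by [].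
apply/eqP; rewrite eqn_leq; apply/andP; split.
  apply/bigmax_leqP=> s /chamber_exists[c /chamberP[_ <- _ _]].
  exact: subset_leq_card.
have /set0Pn[s /chamber_exists[c /chamberP[Xc <- _ _] _]] := X_neq0.
exact: (@leq_bigmax_cond _ (mem X) (fun s : {set V} => #|s|) c).
Qed.

Lemma weightE s : weight X s = #|[set c in chambers | s \subset c]|.
Proof.
by rewrite /weight dimensionE; apply: eq_card => c; rewrite !inE andbA.
Qed.

Lemma weight_gt0 s : s \in X -> (0 < weight X s)%N.
Proof.
case/chamber_exists=> c Cc s_sc; rewrite weightE; apply/card_gt0P.
by exists c; rewrite inE Cc.
Qed.

Lemma weight_sum s (a : R) :
  (weight X s)%:R * a = \sum_(c in chambers | s \subset c) a.
Proof.
rewrite weightE mulr_natl -sumr_const.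
by apply: eq_bigl => c; rewrite inE.
Qed.

Variable i : nat.
Implicit Type u : cochain R X i.
Implicit Type t : {ffun 'I_i.+1 -> V}.

Lemma cochain0 u t : ~~ ordered_simplex X t -> u t = 0.
Proof. by case: u => u /= /is_cochainP[u0 _]; apply: u0. Qed.

Lemma cochainN u t (s : 'S_i.+1) : u (reorder t s) = (-1) ^+ s * u t.
Proof. by case: u => u /= /is_cochainP[_]; apply. Qed.

Lemma ordered_simplex_cons v t : ordered_simplex X t ->
  ordered_simplex X (cons_vertex v t) =
    (v \notin vertex_set t) && (v |: vertex_set t \in X).
Proof.
case/andP=> inj_t _.
by rewrite /ordered_simplex injective_cons inj_t andbT vertex_set_cons.
Qed.

(** The sign of the face omitting [t j] is opposite to the sign of the cycle in [face_consS], so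
    every [j] contributes with a minus. *)
Lemma coboundary_cons u v t : ordered_simplex X (cons_vertex v t) ->
  coboundary u (cons_vertex v t) = u t - \sum_j u (replace t j v).
Proof.
move=> Xvt; rewrite ffunE Xvt big_ord_recl expr0 mul1r face_cons0 -sumrN.
congr (_ + _); apply: eq_bigr => j _.
rewrite face_consS cochainN odd_lift_perm odd_perm1 addbF /=.
by rewrite exprS -signr_odd mulN1r mulNr signrMK.
Qed.

(** The [n - i] vertices of [c] outside [t] give that many copies of [u t]. Letting [v] run over the
    vertices of [t] as well adds [u t] once for each [j], from [v = t j], and zero from the tuples
    with a repeated vertex: [i + 1] further copies. *)
Lemma sum_chamber u t c :
    c \in chambers -> ordered_simplex X t -> vertex_set t \subset c ->
  \sum_(v in c | v \notin vertex_set t) (u t - \sum_j u (replace t j v)) =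
    n.+1%:R * u t - \sum_j \sum_(v in c) u (replace t j v).
Proof.
move=> /chamberP[_ card_c _ _] /andP[inj_t _] t_c.
rewrite sumrB sumr_const exchange_big /=.
have card_t : #|vertex_set t| = i.+1.
  by rewrite card_imset ?card_ord //; apply/injectiveP.
have -> : #|[pred v in c | v \notin vertex_set t]| = (n.+1 - i.+1)%N.
  rewrite -card_c -card_t -(cardsID (vertex_set t) c) (setIidPr t_c) addKn.
  by apply: eq_card => v; rewrite !inE andbC.
have -> : \sum_j \sum_(v in c) u (replace t j v) =
    u t *+ i.+1 + \sum_j \sum_(v in c | v \notin vertex_set t) u (replace t j v).
  have -> : u t *+ i.+1 = \sum_(j < i.+1) u t by rewrite sumr_const card_ord.
  rewrite -big_split /=; apply: eq_bigr => j _.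
  rewrite (bigID (mem (vertex_set t))) /=; congr (_ + _).
  have tj_c : (t j \in c) && (t j \in vertex_set t).
    by rewrite mem_vertex_set (vertex_set_subP _ _ t_c).
  rewrite (bigD1 (t j)) //= replace_id big1 ?addr0 // => v.
  case/andP=> /andP[_ /imsetP[k _ ->]] ntkj.
  apply: cochain0; rewrite negb_and replace_noninjective //.
  by apply: contraNneq ntkj => ->.
rewrite opprD addrA mulr_natl -mulrnBr //.
by rewrite -card_t -card_c subset_leq_card.
Qed.

(** The weight of [t] cancels the denominator. That of [[v, t]] counts the chambers containing both
    [v] and [t], so exchanging the sums groups the terms by chamber. *)
Lemma weight_laplacian u t : ordered_simplex X t ->
  (weight X (vertex_set t))%:R * laplacian R X i u t =
  \sum_(c in chambers | vertex_set t \subset c)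
    (n.+1%:R * u t - \sum_j \sum_(v in c) u (replace t j v)).
Proof.
move=> Xt; have /andP[inj_t X_t] := Xt.
rewrite /laplacian /= ffunE Xt mulr_sumr.
transitivity (\sum_(v | ordered_simplex X (cons_vertex v t))
  \sum_(c in chambers | vertex_set (cons_vertex v t) \subset c)
     (u t - \sum_j u (replace t j v))).
  apply: eq_bigr => v Xvt; rewrite -weight_sum mulrA mulrCA mulfV ?mulr1.
    by rewrite -coboundary_cons.
  by rewrite pnatr_eq0 -lt0n weight_gt0.
rewrite (exchange_big_dep (fun c => (c \in chambers) && (vertex_set t \subset c))) /=.
  apply: eq_bigr => c /andP[Cc t_c]; rewrite -sum_chamber //.
  apply: eq_bigl => v.
  rewrite ordered_simplex_cons // vertex_set_cons subUset sub1set t_c Cc andbT.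
  rewrite andbC andbA; case c_v: (v \in c) => //=.
  case: (v \notin _) => //=; have [Xc _ _ _] := chamberP Cc.
  apply: X_closed Xc _ _; first by rewrite subUset sub1set c_v.
  by apply/set0Pn; exists v; rewrite !inE eqxx.
move=> v c; rewrite vertex_set_cons subUset => _ /andP[-> /andP[_ ->]] //.
Qed.

Lemma laplacian_le b : is_eigenvalue (laplacian R X i) b -> b <= n.+1%:R.
Proof.
case=> u u_neq0 def_b; rewrite -subr_ge0.
(* The sum runs over all orderings, so [E] is [(i + 1)!] times the norm [(u, u)]; tuples that order
   no simplex contribute 0. *)
pose E := \sum_t (weight X (vertex_set t))%:R * (u t * u t).
have E_ge0 t : 0 <= (weight X (vertex_set t))%:R * (u t * u t).
  by rewrite mulr_ge0 // -expr2 sqr_ge0.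
have E_gt0 : 0 < E.
  rewrite lt0r sumr_ge0 // andbT psumr_neq0 //.
  have /existsP[t ut] : [exists t, u t != 0].
    apply: contraNT u_neq0 => /existsPn u0; apply/eqP/val_inj/ffunP=> t.
    by move/negPn/eqP: (u0 t) => ut; rewrite ffunE.
  apply/hasP; exists t; rewrite ?mem_index_enum //=.
  have [/andP[_ X_t]|/(cochain0 u) ut0] := boolP (ordered_simplex X t); last first.
    by rewrite ut0 eqxx in ut.
  by rewrite mulr_gt0 ?ltr0n ?weight_gt0 // -expr2 exprn_even_gt0.
rewrite -(pmulr_lge0 _ E_gt0).
have -> : (n.+1%:R - b) * E = \sum_(c in chambers) \sum_j
    \sum_(t | vertex_set t \subset c) \sum_(v in c) u t * u (replace t j v).
  have -> : (n.+1%:R - b) * E = \sum_t \sum_(c in chambers | vertex_set t \subset c)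
      u t * \sum_j \sum_(v in c) u (replace t j v).
    rewrite mulr_sumr; apply: eq_bigr => t _.
    have [Xt|/(cochain0 u) ->] := boolP (ordered_simplex X t); last first.
      by rewrite !mulr0 big1 // => c _; rewrite mul0r.
    rewrite -mulr_sumr.
    have := weight_laplacian u Xt; rewrite def_b /= ffunE sumrB -weight_sum.
    set F := \sum_(c in chambers | _) _; rewrite -[b *: _]/(b * u t) => def_F.
    have -> : F = (weight X (vertex_set t))%:R * ((n.+1%:R - b) * u t).
      by rewrite mulrBl mulrBr def_F opprB addrC subrK.
    by ring.
  rewrite (exchange_big_dep (mem chambers)) /=; last by move=> t c _ /andP[].
  apply: eq_bigr => c Cc; rewrite exchange_big.
  apply: eq_big => [t|t _]; first by rewrite Cc.
  by rewrite mulr_sumr; apply: eq_bigr => j _; rewrite mulr_sumr.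
by apply: sumr_ge0 => c _; apply: sumr_ge0 => j _; apply: sum_replace_ge0.
Qed.


(** * A coclosed cochain attaining the bound *)

Section Eigenvector.

Variable e : 'I_i.+2 -> K.
Hypotheses (e_inj : injective e) (e_A : forall b, e b \in A).

(* [\det (colour_mx t)] is the value at [tau \o t] of the codifferential of the
   oriented simplex [e] in the full simplex on [A]. *)
Definition colour_mx t : 'M[R]_i.+2 :=
  \matrix_(a, b) if unlift ord0 a is Some k then (tau (t k) == e b)%:R else 1.

Definition colour_cochain_fun : {ffun {ffun 'I_i.+1 -> V} -> R^o} :=
  [ffun t => if ordered_simplex X t then \det (colour_mx t) else 0].

Lemma colour_cochain_subproof : colour_cochain_fun \in @is_cochain R V X i.
Proof.
apply/is_cochainP; split=> [t /negPf Xt|t s]; first by rewrite ffunE Xt.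
rewrite !ffunE ordered_simplex_reorder; case: ifP => _; last by rewrite mulr0.
have -> : colour_mx (reorder t s) = row_perm (lift_perm ord0 ord0 s) (colour_mx t).
  apply/matrixP=> a b; rewrite !mxE; case: (unliftP ord0 a) => [k ->|->].
    by rewrite lift_perm_lift !liftK ffunE.
  by rewrite lift_perm_id !unlift_none.
by rewrite row_permE det_mulmx det_perm odd_lift_perm.
Qed.

Definition colour_cochain : cochain R X i := Cochain colour_cochain_subproof.

(** A tuple in a chamber fails to order a simplex only by repeating a vertex; two rows of the matrix
    then agree and the determinant vanishes anyway. *)
Lemma colour_cochainE c t : c \in chambers -> vertex_set t \subset c ->
  colour_cochain t = \det (colour_mx t).
Proof.
move=> /chamberP[Xc _ _ _] t_c; rewrite ffunE; case: ifPn => // /nandP[|]; last first.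
  by rewrite (X_closed Xc t_c) // vertex_set_neq0.
case/injectivePn=> k [k' nkk' eq_t]; apply/esym.
apply: (@determinant_alternate _ _ _ (lift ord0 k) (lift ord0 k')) => [|b].
  by rewrite (inj_eq lift_inj).
by rewrite !mxE !liftK eq_t.
Qed.

(** Only the row of index [lift ord0 j] depends on [v]. Each colour [e b] occurs exactly once in
    [c], so summing over [v] makes this row constant 1, equal to the row [ord0]. *)
Lemma sum_colour_cochain c t j : c \in chambers -> vertex_set t \subset c ->
  \sum_(v in c) colour_cochain (replace t j v) = 0.
Proof.
move=> Cc t_c; have [_ _ inj_c im_c] := chamberP Cc.
pose a := lift ord0 j.
pose M1 : 'M[R]_i.+2 := \matrix_(a', b) if a' == a then 1 else colour_mx t a' b.
(* Expanding along the row [a] leaves cofactors that do not see [v]. *)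
have cofE v b : cofactor (colour_mx (replace t j v)) a b = cofactor M1 a b.
  congr (_ * \det _); apply/matrixP=> p q; rewrite !mxE eq_sym (negPf (neq_lift _ _)).
  case: unliftP => [k def_p|//]; rewrite ffunE; case: (k =P j) => // def_k.
  by have := neq_lift a p; rewrite def_p def_k eqxx.
transitivity (\det M1).
  rewrite (expand_det_row _ a).
  have -> : \sum_(v in c) colour_cochain (replace t j v) =
      \sum_(v in c) \sum_b colour_mx (replace t j v) a b * cofactor M1 a b.
    apply: eq_bigr => v c_v; rewrite (colour_cochainE Cc) ?vertex_set_replace_sub //.
    by rewrite (expand_det_row _ a); apply: eq_bigr => b _; rewrite cofE.
  rewrite exchange_big; apply: eq_bigr => b _; rewrite -mulr_suml mxE eqxx.
  congr (_ * _); have := e_A b; rewrite -im_c => /imsetP[v0 c_v0 def_eb].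
  rewrite (bigD1 v0) //= mxE liftK ffunE def_eb !eqxx big1 ?addr0 // => v /andP[c_v ne_v].
  rewrite mxE liftK ffunE def_eb eqxx; case: eqP => // /(inj_c _ _ c_v c_v0) eq_v.
  by rewrite eq_v eqxx in ne_v.
apply: (@determinant_alternate _ _ _ a ord0) => [|b]; first by rewrite eq_sym neq_lift.
by rewrite [LHS]mxE eqxx [RHS]mxE; case: (ord0 == a); rewrite ?mxE ?unlift_none.
Qed.

Lemma laplacian_colour_cochain :
  laplacian R X i colour_cochain = n.+1%:R *: colour_cochain.
Proof.
apply/val_inj/ffunP=> t; rewrite [RHS]ffunE.
rewrite -[LHS]/(laplacian R X i colour_cochain t) -[X in _ *: X]/(colour_cochain t).
have [Xt|nXt] := boolP (ordered_simplex X t); last first.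
  by rewrite !(cochain0 _ nXt) scaler0.
have w_neq0 : (weight X (vertex_set t))%:R != 0 :> R.
  by case/andP: Xt => _ X_t; rewrite pnatr_eq0 -lt0n weight_gt0.
apply: (mulfI w_neq0); rewrite [LHS]weight_laplacian //.
rewrite weight_sum; apply: eq_bigr => c /andP[Cc t_c].
by rewrite big1 ?subr0 // => j _; apply: sum_colour_cochain.
Qed.

(** On a tuple of a chamber with colours [e 1], ..., [e (i + 1)], the matrix has a first row of ones
    and unit vectors below: it is unitriangular, of determinant 1. *)
Lemma colour_cochain_neq0 : colour_cochain != 0.
Proof.
have /set0Pn[s /chamber_exists[c Cc _]] := X_neq0.
have [Xc _ inj_c im_c] := chamberP Cc.
have ex_v k : exists v, (v \in c) && (tau v == e (lift ord0 k)).
  have := e_A (lift ord0 k); rewrite -im_c => /imsetP[v c_v ->].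
  by exists v; rewrite c_v eqxx.
pose t : {ffun 'I_i.+1 -> V} := [ffun k => xchoose (ex_v k)].
have t_c : vertex_set t \subset c.
  by apply/vertex_set_subP=> k; rewrite ffunE; case/andP: (xchooseP (ex_v k)).
have tau_t k : tau (t k) = e (lift ord0 k).
  by rewrite ffunE; case/andP: (xchooseP (ex_v k)) => _ /eqP.
suff t1 : colour_cochain t = 1.
  by apply: contraTneq (oner_neq0 R) => u0; rewrite -t1 u0 ffunE eqxx.
rewrite (colour_cochainE Cc t_c) -det_tr det_trig.
  rewrite big1 // => a _; rewrite !mxE; case: unliftP => // k ->.
  by rewrite tau_t eqxx.
apply/is_trig_mxP=> a b lt_ab; rewrite !mxE; case: unliftP => [k def_b|def_b].
  by rewrite tau_t (inj_eq e_inj) -def_b eq_sym -val_eqE /= ltn_eqF.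
by rewrite def_b in lt_ab.
Qed.

End Eigenvector.

Theorem max_eigenvalue_coloured : (i < n)%N ->
  is_max_eigenvalue (laplacian R X i) n.+1%:R.
Proof.
move=> lt_in; split; last exact: laplacian_le.
(* This is where [i < n] enters: [i + 2] distinct colours are chosen in [A]. *)
have le_i : (i.+2 <= #|A|)%N by rewrite cardA ltnS.
pose e (b : 'I_i.+2) : K := enum_val (widen_ord le_i b).
have e_inj : injective e by move=> b b' /enum_val_inj/(congr1 val)/= /val_inj.
have e_A b : e b \in A by apply: enum_valP.
exists (colour_cochain e); first exact: colour_cochain_neq0.
exact: laplacian_colour_cochain.
Qed.

End ColouredComplex.

(** * The building as a complex coloured by [S] *)

Section TitsBuilding.

Import GroupScope.

Variables (gT : finGroupType) (G B N : {group gT}).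
Variable S : {set coset_of (B :&: N)}.
Hypothesis hTits : tits_system G B N S.

Let T := B :&: N.
Implicit Types (s : coset_of T) (I J : {set coset_of T}) (M P X : {group gT}).

Lemma proper_parabolicJ P g : g \in G ->
  proper_parabolic G B (P :^ g)%G = proper_parabolic G B P.
Proof.
suff sub h Q : h \in G -> proper_parabolic G B Q -> proper_parabolic G B (Q :^ h)%G.
  move=> Gg; apply/idP/idP; last exact: sub.
  move/(sub g^-1 _ (groupVr Gg)); congr proper_parabolic.
  by apply: val_inj; rewrite /= conjsgK.
move=> Gh /andP[ltQG /existsP[k /andP[Gk sBkQ]]]; rewrite /proper_parabolic.
rewrite -{1}(conjGid Gh) properJ ltQG; apply/existsP; exists (k * h).
by rewrite groupM // conjsgM conjSg.
Qed.

Lemma maximal_parabolicJ M g : g \in G ->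
  maximal_parabolic G B (M :^ g)%G = maximal_parabolic G B M.
Proof.
suff sub h Q : h \in G -> maximal_parabolic G B Q -> maximal_parabolic G B (Q :^ h)%G.
  move=> Gg; apply/idP/idP; last exact: sub.
  move/(sub g^-1 _ (groupVr Gg)); congr maximal_parabolic.
  by apply: val_inj; rewrite /= conjsgK.
move=> Gh /maxgroupP[ppQ maxQ]; apply/maxgroupP; split.
  by rewrite proper_parabolicJ.
move=> H ppH sQH; have Gh' := groupVr Gh.
have eqQ : H :^ h^-1 = Q.
  apply: (maxQ (H :^ h^-1)%G); first by rewrite proper_parabolicJ.
  by rewrite /= -sub_conjg.
by rewrite /= -eqQ conjsgKV.
Qed.

Lemma proper_std_parabolic I s : I \subset S -> s \in S -> s \notin I ->
  proper_parabolic G B (std_parabolic I).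
Proof.
move=> sIS Ss nIs; apply/andP; split.
  rewrite properEneq (std_parabolic_subG hTits) // andbT.
  apply: contra nIs => /eqP/val_inj defG.
  rewrite -(coset_in_std_parabolic hTits sIS Ss) defG -(std_parabolic_full hTits).
  exact: coset_sub_std_parabolic.
by apply/existsP; exists 1; rewrite group1 conjsg1 sub_std_parabolic.
Qed.

Definition std_maximal s : {group gT} := std_parabolic (S :\ s).

(** A proper overgroup is generated by [B] and a subset of [S] containing [S :\ s]; this subset
    cannot contain [s], or the group would be [G]. *)
Lemma maximal_std_maximal s : s \in S -> maximal_parabolic G B (std_maximal s).
Proof.
move=> Ss; apply/maxgroupP; split.
  by apply: (@proper_std_parabolic _ s); rewrite ?subD1set // !inE eqxx.
move=> H /andP[ltHG _] sMH; have sBH := subset_trans (sub_std_parabolic _) sMH.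
have sHG := proper_sub ltHG; rewrite (overgroup_std hTits sBH sHG).
congr (gval (std_parabolic _)); apply/setP=> t; rewrite !inE.
have [->|ne_ts] := eqVneq t s => /=; last first.
  case: (boolP (t \in S)) => //= St; apply: subset_trans sMH.
  by apply: coset_sub_std_parabolic; rewrite !inE ne_ts.
apply/andP=> [[_ sH]]; case/andP: ltHG => _ /negP[].
rewrite -(std_parabolic_full hTits); apply: std_parabolic_sub => // r Sr.
have [->//|ne_rs] := eqVneq r s; apply: subset_trans sMH.
by apply: coset_sub_std_parabolic; rewrite !inE ne_rs.
Qed.

Lemma std_maximal_exists M : maximal_parabolic G B M -> B \subset M ->
  exists2 s, s \in S & M = std_maximal s.
Proof.
case/maxgroupP=> /andP[ltMG _] maxM sBM.
have defM := overgroup_std hTits sBM (proper_sub ltMG).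
set I := [set s in S | _] in defM.
have sIS : I \subset S by apply/subsetP=> s; rewrite inE => /andP[].
have /subsetPn[s Ss nIs] : ~~ (S \subset I).
  apply: contraL ltMG => sSI; have defI : I = S by apply/eqP; rewrite eqEsubset sIS.
  by rewrite defM defI (std_parabolic_full hTits) properxx.
exists s => //; apply/val_inj/esym/maxM.
  by case/maxgroupP: (maximal_std_maximal Ss).
rewrite defM; apply: std_parabolicS; apply/subsetP=> t It.
by rewrite !inE (subsetP sIS) // andbT; apply: contraNneq nIs => <-.
Qed.

Lemma std_maximal_conj_exists M g : g \in G -> maximal_parabolic G B M ->
  B :^ g \subset M -> exists2 s, s \in S & M = (std_maximal s :^ g)%G.
Proof.
move=> Gg maxM sBM; have [||s Ss defM] := @std_maximal_exists (M :^ g^-1)%G.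
- by rewrite maximal_parabolicJ ?groupV.
- by rewrite /= -sub_conjg.
by exists s; rewrite // -defM; apply: val_inj; rewrite /= conjsgKV.
Qed.

Lemma std_maximal_inj s t : s \in S -> t \in S ->
  std_maximal s :=: std_maximal t -> s = t.
Proof.
move=> Ss St eq_st; apply: contraTeq (Ss) => ne_st.
suff: s \in S :\ s by rewrite !inE eqxx.
rewrite -(coset_in_std_parabolic hTits) ?subD1set // -/(std_maximal s) eq_st.
by apply: coset_sub_std_parabolic; rewrite !inE ne_st.
Qed.

(** By [normalizing], the conjugating element [g * h^-1] already lies in [std_maximal t], so the two
    standard groups are equal. *)
Lemma std_maximal_conj_inj s t g h : s \in S -> t \in S -> g \in G -> h \in G ->
  std_maximal s :^ g = std_maximal t :^ h -> s = t.
Proof.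
move=> Ss St Gg Gh eq_st; apply: std_maximal_inj => //.
have eq_t : std_maximal s :^ (g * h^-1) = std_maximal t.
  by rewrite conjsgM eq_st conjsgK.
suff Mk : g * h^-1 \in std_maximal t by rewrite -(conjGid (groupVr Mk)) -eq_t conjsgK.
apply: (normalizing hTits); rewrite ?sub_std_parabolic ?groupM ?groupV //.
  by rewrite (std_parabolic_subG hTits) ?subD1set.
by rewrite -eq_t conjSg sub_std_parabolic.
Qed.

(** The default [1] is not in [S]; it marks the groups that are not vertices. *)
Definition vertex_type M : coset_of T :=
  odflt 1 [pick s in S | [exists g in G, M == (std_maximal s :^ g)%G]].

Lemma vertex_typeE s g : s \in S -> g \in G ->
  vertex_type (std_maximal s :^ g)%G = s.
Proof.
move=> Ss Gg; rewrite /vertex_type; case: pickP => [t /andP[St]|/(_ s)]; last first.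
  by rewrite Ss /=; case/existsP; exists g; rewrite Gg eqxx.
by case/existsP=> h /andP[Gh /eqP/(congr1 val)/= /esym]; apply: std_maximal_conj_inj.
Qed.

(** The face of type [J] of the chamber of [B :^ g]. *)
Definition std_simplex J g : {set {group gT}} := [set (std_maximal s :^ g)%G | s in J].

(** The vertices above [B :^ g] are the conjugates by [g] of the [std_maximal s], and such a vertex
    lies above the given group exactly when [s] is not among its generators [S :\: J]. *)
Lemma parabolic_simplex_std J g : J \subset S -> g \in G ->
  parabolic_simplex G B (std_parabolic (S :\: J) :^ g)%G = std_simplex J g.
Proof.
move=> /subsetP sJS Gg; apply/setP=> M; rewrite inE.
apply/andP/imsetP=> [[maxM sPM] | [s Js ->]]; last first.
  rewrite maximal_parabolicJ // maximal_std_maximal ?sJS //= conjSg.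
  by rewrite std_parabolicS // setDS // sub1set.
have [|s Ss defM] := std_maximal_conj_exists Gg maxM.
  by apply: subset_trans sPM; rewrite /= conjSg sub_std_parabolic.
exists s => //; apply: contraLR sPM => nJs; rewrite defM /= conjSg.
apply/negP=> sPM; suff: s \in S :\ s by rewrite !inE eqxx.
rewrite -(coset_in_std_parabolic hTits) ?subD1set //.
by apply: subset_trans sPM; apply: coset_sub_std_parabolic; rewrite inE nJs.
Qed.

Lemma std_simplex_building J g : J \subset S -> J != set0 -> g \in G ->
  std_simplex J g \in building G B.
Proof.
move=> sJS /set0Pn[s Js] Gg; rewrite -parabolic_simplex_std //; apply: imset_f.
rewrite inE proper_parabolicJ //; apply: (@proper_std_parabolic _ s).
- exact: subsetDl.
- exact: (subsetP sJS).
- by rewrite inE Js.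
Qed.

Lemma building_sub_chamber (s : {set {group gT}}) : s \in building G B ->
  exists2 g, g \in G & s \subset std_simplex S g.
Proof.
case/imsetP=> P; rewrite inE => /andP[_ /existsP[g /andP[Gg sBgP]]] ->.
exists g => //; apply/subsetP=> M; rewrite inE => /andP[maxM sPM].
have [t St ->] := std_maximal_conj_exists Gg maxM (subset_trans sBgP sPM).
exact: imset_f.
Qed.

(** A subset of a chamber is the face whose type is the set of its colours. *)
Lemma building_closed (s r : {set {group gT}}) :
  s \in building G B -> r \subset s -> r != set0 -> r \in building G B.
Proof.
case/building_sub_chamber=> g Gg s_g r_s r_neq0.
pose J := [set t in S | (std_maximal t :^ g)%G \in r].
have def_r : r = std_simplex J g.
  apply/setP=> M; apply/idP/imsetP=> [r_M | [t]]; last by rewrite inE => /andP[_ ?] ->.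
  have /imsetP[t St defM] := subsetP s_g M (subsetP r_s M r_M).
  by exists t; rewrite // inE St -defM.
rewrite def_r std_simplex_building //; first by apply/subsetP=> t; rewrite inE => /andP[].
by apply: contraNneq r_neq0 => J0; rewrite def_r J0 /std_simplex imset0.
Qed.

Lemma vertex_type_chamber g : g \in G ->
  {in std_simplex S g &, injective vertex_type} /\ vertex_type @: std_simplex S g = S.
Proof.
move=> Gg; split=> [_ _ /imsetP[s Ss ->] /imsetP[t St ->]|].
  by rewrite !vertex_typeE // => ->.
apply/setP=> s; apply/imsetP/idP=> [[_ /imsetP[t St ->] ->]|Ss].
  by rewrite vertex_typeE.
by exists (std_maximal s :^ g)%G; rewrite ?vertex_typeE //; apply: imset_f.
Qed.

End TitsBuilding.

Local Open Scope ring_scope.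

Theorem theorem2p21 (R : realType) (gT : finGroupType) (G B N : {group gT})
    (S : {set coset_of (B :&: N)}) (l : nat)
    (hTits : tits_system G B N S) (hrank : #|S| = l.+1)
    (i : nat) (hi : (i < l)%N) :
  is_max_eigenvalue (laplacian R (building G B) i) (l.+1)%:R.
Proof.
have S_neq0 : S != set0 by rewrite -card_gt0 hrank.
(* The colours are the elements of [S], whence [n = l]. *)
apply: (max_eigenvalue_coloured R (tau := vertex_type G S) hrank) => //.
- apply/set0Pn; exists (std_simplex S S 1%g).
  by apply: std_simplex_building (subxx S) S_neq0 _; rewrite ?group1.
- exact: building_closed hTits.
move=> s /(building_sub_chamber hTits)[g Gg s_g].
have [inj_g im_g] := vertex_type_chamber hTits Gg.
exists (std_simplex S S g); split=> //.
by apply: std_simplex_building (subxx S) S_neq0 Gg.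
Qed.
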